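(* Consider straight lines in the Euclidean plane among which there is no pair of parallel lines and no three lines that intersect in one point. With the circles and points determined successively as described in the context, the following hold. (i) Given three straight lines, a circle may be drawn through their intersections. (ii) Given four straight lines, the four circles so determined meet in a point. (iii) Given five straight lines, the five points so found lie on a circle. (iv) Given six straight lines, the six circles so determined meet in a point. This continues indefinitely: for every $n\ge 2$, $2n$ straight lines determine $2n$ circles all meeting in a point, and for $2n+1$ straight lines the $2n+1$ points so found lie on the same circle.
   Context: The circles and points are determined successively, according to the number of lines. - Two lines determine their intersection point. - Three lines determine the circle through their three pairwise intersection points. - Given four lines, omitting each line in turn leaves three lines. The four circles of these triples are the circles ''so determined'', and the point in which they meet is the point determined by the four lines. - Given five lines, omitting each line in turn leaves four lines. The five points determined by these quadruples are the points ''so found'', and the circle on which they lie is the circle determined by the five lines. - In general, given $2n$ lines ($n\ge 2$), the $2n$ circles so determined are those determined by the $2n$ subsets of $2n-1$ lines obtained by omitting one line. The point in which they meet is the point determined by the $2n$ lines. - Given $2n+1$ lines ($n\ge 2$), the $2n+1$ points so found are those determined by the $2n+1$ subsets of $2n$ lines obtained by omitting one line. The circle on which they lie is the circle determined by the $2n+1$ lines.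
   Formalization: From five lines on, ''circle'' may also be a straight line and circles may meet at one added point at infinity; for six or more lines the circles (points) are assumed uniquely determined at each step, otherwise only a consistent choice of points and circles is asserted. *)

(* Defs.v *)
From HB Require Import structures.
From mathcomp Require Import all_boot all_order all_algebra.
From mathcomp Require Import boolp classical_sets reals.

Set Implicit Arguments.
Unset Strict Implicit.
Unset Printing Implicit Defensive.

Import Order.TTheory GRing.Theory Num.Theory.
Local Open Scope ring_scope.

Definition plane (R : realType) : Type := (R * R)%type.

Definition is_line (R : realType) (L : set (plane R)) : Prop :=
  exists a b d : R, (a != 0 \/ b != 0) /\
    L = [set x : plane R | a * x.1 + b * x.2 = d]%classic.

Definition is_circle (R : realType) (C : set (plane R)) : Prop :=
  exists a b r : R, 0 < r /\
    C = [set x : plane R | (x.1 - a) ^+ 2 + (x.2 - b) ^+ 2 = r ^+ 2]%classic.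

(* A line counts as parallel to itself, so pairwise non-parallel lines are
   distinct. *)
Definition parallel (R : realType) (L M : set (plane R)) : Prop :=
  L = M \/ ~ (exists x, L x /\ M x).

Definition general_position (R : realType) (I : finType)
    (l : I -> set (plane R)) : Prop :=
  [/\ forall i, is_line (l i),
      forall i j, i != j -> ~ parallel (l i) (l j)
    & forall i j k, i != j -> i != k -> j != k ->
        ~ (exists x, [/\ l i x, l j x & l k x])].

(* The plane with one point at infinity, [None], added.  From five lines on, the
   circles have to be understood in this plane, a straight line through [None]
   being a circle: there are five lines in general position whose five points
   are distinct and collinear, and six lines in general position whose six
   circles are straight lines with only [None] in common. *)
Definition xplane (R : realType) : Type := option (plane R).

Definition is_xcircle (R : realType) (C : set (xplane R)) : Prop :=
  (exists2 c, is_circle c & C = [set Some x | x in c]%classic) \/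
  (exists2 L, is_line L & C = ([set Some x | x in L] `|` [set None])%classic).

(* The points and circles determined by the subfamilies [S] of the lines [l].
   To be determined means to be the only point common to the circles, or the
   only circle through the points, determined by the subfamilies [S :\ i].
   Uniqueness can fail from five lines on: if the lines are tangent to one
   parabola, their five points all coincide with its focus. *)
Inductive determined_point (R : realType) (I : finType)
    (l : I -> set (plane R)) : {set I} -> xplane R -> Prop :=
  | Determined_intersection (i j : I) (x : plane R) :
      i != j -> l i x -> l j x -> determined_point l [set i; j]%SET (Some x)
  | Determined_point (S : {set I}) (c : I -> set (xplane R)) (p : xplane R) :
      (4 <= #|S|)%N ->
      (forall i, i \in S -> determined_circle l (S :\ i)%SET (c i)) ->
      (forall i, i \in S -> c i p) ->
      (forall q, (forall i, i \in S -> c i q) -> q = p) ->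
      determined_point l S p
with determined_circle (R : realType) (I : finType)
    (l : I -> set (plane R)) : {set I} -> set (xplane R) -> Prop :=
  | Determined_circle (S : {set I}) (p : I -> xplane R) (C : set (xplane R)) :
      (3 <= #|S|)%N ->
      (forall i, i \in S -> determined_point l (S :\ i)%SET (p i)) ->
      is_xcircle C -> (forall i, i \in S -> C (p i)) ->
      (forall D, is_xcircle D -> (forall i, i \in S -> D (p i)) -> D = C) ->
      determined_circle l S C.

(* A simultaneous choice of a point [P S] for every even and of a circle [C S]
   for every odd subfamily with all the required incidences; it also makes sense
   when some of these circles or points fail to be unique.  The values of [P]
   and [C] at the other subfamilies are irrelevant. *)
Definition clifford_chain (R : realType) (I : finType) (l : I -> set (plane R))
    (P : {set I} -> xplane R) (C : {set I} -> set (xplane R)) : Prop :=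
  [/\ forall i j, i != j ->
        exists x, [/\ l i x, l j x & P [set i; j]%SET = Some x],
      forall S : {set I}, odd #|S| -> (3 <= #|S|)%N ->
        is_xcircle (C S) /\ (forall i, i \in S -> C S (P (S :\ i)%SET))
    & forall S : {set I}, ~~ odd #|S| -> (4 <= #|S|)%N ->
        forall i, i \in S -> C (S :\ i)%SET (P S)].

(* Main.v *)
Require Import Defs.
From HB Require Import structures.
From mathcomp Require Import all_boot all_order all_algebra.
From mathcomp Require Import boolp classical_sets reals.
From mathcomp Require Import complex ring lra zify.

(* Choose a pencil parameter [u] in which the lines of the plane are the
   equations [X + u Y = d], with [X + i Y] a similarity image of [x + i y].  For
   [2 m] lines, interpolate [(u_i, d_i)] by a real rational function [N / D] with
   [deg N <= m] and [deg D < m]: the lines [(u, N u / D u)] envelop a curve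
   touching all given lines and [m - 1] times the line at infinity, and Clifford's
   point is its focus [N i / D i] (in the coordinate [X + i Y]).  For [2 m + 1]
   lines, the solutions of the interpolation problem with [deg N <= m + 1] and
   [deg D <= m] contain those of the problems for one line less (times a linear
   factor) and for one line more.  They form a real plane, and their values at
   [i] a circle, unless they are all one rational function, in which case all
   these points coincide. *)

Set Implicit Arguments.
Unset Strict Implicit.
Unset Printing Implicit Defensive.

Import Order.TTheory GRing.Theory Num.Theory.

(** * Rational interpolation over a field *)

Section Interpolation.
Local Open Scope ring_scope.
Variables (F : fieldType) (I : finType) (u : I -> F).

(** The conditions are [#|S|] homogeneous linear equations in more unknowns, the [a + b]
    coefficients. *)
Lemma rational_interpolant (S : {set I}) (d : I -> F) (a b : nat) :
  (#|S| < a + b)%N ->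
  exists N D : {poly F}, [/\ (N != 0) || (D != 0), (size N <= a)%N,
    (size D <= b)%N & forall i, i \in S -> N.[u i] = d i * D.[u i]].
Proof.
move=> ltSab.
(* A row vector in the kernel lists the coefficients of [N], then those of [D]; each column is the
   condition at one node. *)
pose M : 'M_(a + b, #|S|) :=
  col_mx (\matrix_(j < a, t < #|S|) u (enum_val t) ^+ j)
         (\matrix_(j < b, t < #|S|) - (d (enum_val t) * u (enum_val t) ^+ j)).
have : kermx M != 0.
  rewrite kermx_eq0 -row_leq_rank -ltnNge.
  by apply: leq_ltn_trans (rank_leq_col M) ltSab.
move=> /rowV0Pn[v /sub_kermxP vM0 vn0].
exists (rVpoly (lsubmx v)), (rVpoly (rsubmx v)); split.
- apply: contraNT vn0; rewrite negb_or !negbK => /andP[/eqP l0 /eqP r0].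
  have l00 : lsubmx v = 0 by rewrite -[lsubmx v]rVpolyK l0 linear0.
  have r00 : rsubmx v = 0 by rewrite -[rsubmx v]rVpolyK r0 linear0.
  by rewrite -[v]hsubmxK l00 r00 row_mx0.
- exact: size_poly.
- exact: size_poly.
move=> i iS; apply/eqP; rewrite -subr_eq0; apply/eqP.
have /matrixP/(_ 0 (enum_rank_in iS i)) := vM0.
rewrite -[v]hsubmxK mul_row_col !mxE hsubmxK => <-.
rewrite !(horner_coef_wide _ (size_poly _ _)) mulr_sumr -sumrN.
congr (_ + _); apply: eq_bigr => j _; rewrite coef_rVpoly_ord.
  by rewrite !mxE enum_rankK_in.
by rewrite !mxE enum_rankK_in // mulrN mulrCA.
Qed.

Hypothesis u_inj : injective u.

(** Dividing by the linear factors at the distinct nodes leaves a constant. This fixes the cross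
    difference of two interpolants up to a scalar. *)
Lemma poly_vanishing_multiple (S : {set I}) (P : {poly F}) :
  (size P <= #|S|.+1)%N -> (forall i, i \in S -> P.[u i] = 0) ->
  exists c, P = c *: \prod_(i in S) ('X - (u i)%:P).
Proof.
move=> sP rP; pose rs := [seq u i | i <- enum S].
have [||q Pq] := @uniq_roots_prod_XsubC _ P rs.
- apply/allP => _ /mapP[i iS ->]; rewrite mem_enum in iS.
  by apply/rootP; exact: rP.
- by rewrite uniq_rootsE map_inj_uniq ?enum_uniq.
have rsE : \prod_(z <- rs) ('X - z%:P) = \prod_(i in S) ('X - (u i)%:P).
  by rewrite big_map big_enum.
have szrs : size (\prod_(z <- rs) ('X - z%:P)) = #|S|.+1.
  by rewrite size_prod_XsubC size_map -cardE.
have sq : (size q <= 1)%N.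
  have [->|q0] := eqVneq q 0; first by rewrite size_poly0.
  move: sP; rewrite Pq size_proper_mul ?szrs; first by
    rewrite addnS /= -addn1 addnC leq_add2l.
  by rewrite mulf_neq0 ?lead_coef_eq0 // -size_poly_eq0 szrs.
exists q`_0; rewrite {1}Pq rsE.
by rewrite {1}(size1_polyC sq) mul_polyC.
Qed.

Lemma poly_vanishing_eq0 (S : {set I}) (P : {poly F}) :
  (size P <= #|S|)%N -> (forall i, i \in S -> P.[u i] = 0) -> P = 0.
Proof.
move=> sP rP; apply: (@roots_geq_poly_eq0 _ P [seq u i | i <- enum S]).
- apply/allP => _ /mapP[i iS ->]; rewrite mem_enum in iS.
  by apply/rootP; exact: rP.
- by rewrite map_inj_uniq ?enum_uniq.
- by rewrite size_map -cardE.
Qed.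

End Interpolation.

(** * Values of real rational functions at the imaginary unit *)

Section Value.
Local Open Scope ring_scope.
Local Open Scope complex_scope.
Variables (R : realType) (k : R[i]).

Definition eval_i (p : {poly R}) : R[i] := (map_poly (real_complex R) p).['i].

Lemma eval_iM p q : eval_i (p * q) = eval_i p * eval_i q.
Proof. by rewrite /eval_i rmorphM hornerM. Qed.

Lemma eval_iB p q : eval_i (p - q) = eval_i p - eval_i q.
Proof. by rewrite /eval_i rmorphB hornerD hornerN. Qed.

Lemma eval_iD p q : eval_i (p + q) = eval_i p + eval_i q.
Proof. by rewrite /eval_i rmorphD hornerD. Qed.

Lemma eval_iZ (c : R) p : eval_i (c *: p) = c%:C * eval_i p.
Proof. by rewrite /eval_i map_polyZ hornerZ. Qed.

Lemma eval_iC (c : R) : eval_i c%:P = c%:C.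
Proof. by rewrite /eval_i map_polyC hornerC. Qed.

Lemma eval_iX : eval_i 'X = 'i.
Proof. by rewrite /eval_i map_polyX hornerX. Qed.

(** Homogeneous coordinates [[Z : W]] on the complex projective line, seen as the plane with [None]
    added. The meaningless pair [0, 0] also gives [None]. *)
Definition xpoint (Z W : R[i]) : xplane R :=
  if W == 0 then None else Some (complex.Re (Z / W), complex.Im (Z / W)).

Lemma xpoint_eq (Z W Z' W' : R[i]) :
  (Z != 0) || (W != 0) -> (Z' != 0) || (W' != 0) -> Z * W' = Z' * W ->
  xpoint Z W = xpoint Z' W'.
Proof.
rewrite /xpoint => nz nz' e.
have [W0|W0] := eqVneq W 0; have [W0'|W0'] := eqVneq W' 0 => //.
- move: nz e; rewrite W0 eqxx orbF mulr0 => Z0 /eqP.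
  by rewrite mulf_eq0 (negbTE Z0) (negbTE W0').
- move: nz' e; rewrite W0' eqxx orbF mulr0 => Z0 /esym/eqP.
  by rewrite mulf_eq0 (negbTE Z0) (negbTE W0).
suff -> : Z / W = Z' / W' by [].
by apply/eqP; rewrite eqr_div // e.
Qed.

Hypothesis k_neq0 : k != 0.

(* The factor [k] of the denominator undoes the similarity of the plane. Dividing
   by the gcd makes the value meaningful when [N] and [D] both vanish at ['i]. *)
Definition ratio_value (N D : {poly R}) : xplane R :=
  xpoint (eval_i (N %/ gcdp N D)) (k * eval_i (D %/ gcdp N D)).

(** A Bezout combination of [N] and [D] is a nonzero constant, which a common zero at ['i] would
    annihilate. *)
Lemma coprimep_eval_i (N D : {poly R}) :
  coprimep N D -> (eval_i N != 0) || (eval_i D != 0).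
Proof.
move=> /Bezout_coprimepP[[v w] /= e1]; rewrite -negb_and; apply/negP.
move=> /andP[/eqP N0 /eqP D0].
move: e1; rewrite -size_poly_eq1 => /size_poly1P[c c0 /(congr1 eval_i)].
rewrite eval_iD !eval_iM N0 D0 !mulr0 addr0 eval_iC => /esym/eqP.
by rewrite (_ : 0 = 0%:C) // (inj_eq (@complexI _)) (negbTE c0).
Qed.

(** The value can be read off any equal fraction that is not [0 / 0] at ['i]: once the gcd is
    cancelled, cross multiplication survives evaluation. *)
Lemma ratio_valueE (N D E F : {poly R}) :
  (N != 0) || (D != 0) -> (eval_i E != 0) || (eval_i F != 0) ->
  N * F = D * E -> ratio_value N D = xpoint (eval_i E) (k * eval_i F).
Proof.
move=> nz nzi e; rewrite /ratio_value.
set g := gcdp N D; set N' := N %/ g; set D' := D %/ g.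
have g0 : g != 0 by rewrite gcdp_eq0 negb_and.
have eN : N = N' * g by rewrite divpK // dvdp_gcdl.
have eD : D = D' * g by rewrite divpK // dvdp_gcdr.
have e' : N' * F = D' * E.
  apply: (mulIf g0); rewrite -mulrA (mulrC F) mulrA -eN e {1}eD; ring.
apply: xpoint_eq; rewrite ?mulf_eq0 ?(negbTE k_neq0) //=.
  exact/coprimep_eval_i/coprimep_div_gcd.
by rewrite mulrCA -eval_iM e' eval_iM; ring.
Qed.

Lemma ratio_value_eq (N D N' D' : {poly R}) :
  (N != 0) || (D != 0) -> (N' != 0) || (D' != 0) -> N * D' = D * N' ->
  ratio_value N D = ratio_value N' D'.
Proof.
move=> nz nz' e; rewrite [RHS]/ratio_value.
set g := gcdp N' D'.
have g0 : g != 0 by rewrite gcdp_eq0 negb_and.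
apply: ratio_valueE => //; first exact/coprimep_eval_i/coprimep_div_gcd.
by apply: (mulIf g0); rewrite -!mulrA !divpK // ?dvdp_gcdl ?dvdp_gcdr.
Qed.

End Value.

(** * Circles of the extended plane as quadrics and as real pencils *)

Section XCircle.
Local Open Scope ring_scope.
Local Open Scope complex_scope.
Variable R : realType.

(** One family of equations for circles and lines. At infinity only the leading coefficient of the
    equation survives, so [None] lies exactly on the quadrics with [q0 = 0]. *)
Definition quadric (q0 q1 q2 q3 : R) : set (xplane R) := fun p =>
  if p is Some x then
    q0 * (x.1 ^+ 2 + x.2 ^+ 2) + q1 * x.1 + q2 * x.2 + q3 = 0
  else q0 = 0.

(** Completing the square gives the squared radius as the discriminant over [4 q0^2]. For [q0 = 0]
    positivity says that the linear part is nonzero. *)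
Lemma quadric_is_xcircle (q0 q1 q2 q3 : R) :
  0 < q1 ^+ 2 + q2 ^+ 2 - 4 * q0 * q3 -> is_xcircle (quadric q0 q1 q2 q3).
Proof.
move=> disc; have [q00|q00] := eqVneq q0 0.
  right; exists [set x : plane R | q1 * x.1 + q2 * x.2 = - q3]%classic.
    exists q1, q2, (- q3); split=> //.
    apply/orP; rewrite -negb_and; apply: contraTN disc => /andP[/eqP-> /eqP->].
    by rewrite q00 expr0n /= mulr0 mul0r addr0 subr0 ltxx.
  apply/seteqP; split=> [[x|]|p] /=; rewrite ?q00.
  - by move=> e; left; exists x => //=; lra.
  - by right.
  - by case=> [[x /= e <-]|-> //=]; rewrite /quadric; lra.
left; set D := _ - _ in disc.
exists [set x : plane R | (x.1 - - q1 / (2 * q0)) ^+ 2 +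
    (x.2 - - q2 / (2 * q0)) ^+ 2 = (Num.sqrt D / (2 * `|q0|)) ^+ 2]%classic.
  exists (- q1 / (2 * q0)), (- q2 / (2 * q0)), (Num.sqrt D / (2 * `|q0|)).
  by split=> //; rewrite divr_gt0 ?sqrtr_gt0 // mulr_gt0 ?normr_gt0.
have eqv (x : plane R) : (x.1 - - q1 / (2 * q0)) ^+ 2 +
    (x.2 - - q2 / (2 * q0)) ^+ 2 - (Num.sqrt D / (2 * `|q0|)) ^+ 2 =
    (q0 * (x.1 ^+ 2 + x.2 ^+ 2) + q1 * x.1 + q2 * x.2 + q3) / q0.
  rewrite [in X in _ - X]expr_div_n sqr_sqrtr ?ltW // exprMn.
  by rewrite real_normK ?num_real // /D; field.
apply/seteqP; split=> [[x|]|_ [x /= e <-]] /=.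
- by move=> e; exists x => //=; apply/eqP; rewrite -subr_eq0 eqv e mul0r.
- by move/eqP; rewrite (negbTE q00).
- move/eqP: e; rewrite -subr_eq0 eqv mulf_eq0 invr_eq0 (negbTE q00) orbF.
  by move/eqP.
Qed.

Lemma det2_eq0 (a b x1 x2 y1 y2 : R) : (a != 0) || (b != 0) ->
  a * x1 + b * y1 = 0 -> a * x2 + b * y2 = 0 -> x1 * y2 - x2 * y1 = 0.
Proof.
move=> nz e1 e2; case/orP: nz => /mulfI; apply; rewrite mulr0.
  by transitivity (y2 * (a * x1 + b * y1) - y1 * (a * x2 + b * y2));
    [ring | rewrite e1 e2; ring].
by transitivity (x1 * (a * x2 + b * y2) - x2 * (a * x1 + b * y1));
  [ring | rewrite e1 e2; ring].
Qed.

(* A real projective line in the complex projective line is a circle. *)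
Lemma real_pencil_xcircle (A B A' B' : R[i]) :
  A * B' - A' * B != 0 ->
  exists2 C : set (xplane R), is_xcircle C &
    forall a b : R, (a != 0) || (b != 0) ->
      C (xpoint (a%:C * A + b%:C * A') (a%:C * B + b%:C * B')).
Proof.
case: A B A' B' => [a1 a2] [b1 b2] [c1 c2] [d1 d2] det0.
(* With [z = x + i y], the quadric is minus the determinant of [A - z B] and [A' - z B'] as real
   plane vectors. It vanishes when [z] is a value of the pencil, since then [a] and [b] give a
   linear relation between them. *)
pose q0 := b2 * d1 - b1 * d2.
pose q1 := a1 * d2 - a2 * d1 + b1 * c2 - b2 * c1.
pose q2 := a1 * d1 + a2 * d2 - b1 * c1 - b2 * c2.
pose q3 := a2 * c1 - a1 * c2.
exists (quadric q0 q1 q2 q3).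
  apply: quadric_is_xcircle.
  (* The discriminant is the squared modulus of [A * B' - A' * B], whose real and imaginary parts
     are [e1] and [e2]. *)
  pose e1 := a1 * d1 - a2 * d2 - (c1 * b1 - c2 * b2).
  pose e2 := a1 * d2 + a2 * d1 - (c1 * b2 + c2 * b1).
  have -> : q1 ^+ 2 + q2 ^+ 2 - 4 * q0 * q3 = e1 ^+ 2 + e2 ^+ 2.
    rewrite /q0 /q1 /q2 /q3 /e1 /e2; ring.
  rewrite lt_def addr_ge0 ?sqr_ge0 // andbT.
  rewrite paddr_eq0 ?sqr_ge0 // !sqrf_eq0.
  by move: det0; rewrite eq_complex /= -/e1 -/e2.
move=> a b nz; rewrite /xpoint.
set W := (X in X == 0); set Z := (X in X / W).
have [W0|W0] := eqVneq W 0.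
  rewrite /quadric -[RHS]oppr0 -(@det2_eq0 a b b1 b2 d1 d2) //.
  - by rewrite /q0; ring.
  - by move: W0; rewrite /W => -[]; lra.
  - by move: W0; rewrite /W => -[]; lra.
rewrite /quadric; case zE: (Z / W) => [x y] /=.
have : Z = (x +i* y) * W by rewrite -zE divfK.
rewrite /Z /W => -[e1 e2].
rewrite -[RHS]oppr0 -(@det2_eq0 a b (a1 - (x * b1 - y * b2)) (a2 - (x * b2 + y * b1))
  (c1 - (x * d1 - y * d2)) (c2 - (x * d2 + y * d1))) //.
- by rewrite /q0 /q1 /q2 /q3; ring.
- by lra.
- by lra.
Qed.
End XCircle.

(** * Spaces of interpolants and the circles formed by their values *)

Section Chain.
Local Open Scope ring_scope.
Local Open Scope complex_scope.
Variables (R : realType) (I : finType) (u d : I -> R) (k : R[i]).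
Hypothesis u_inj : injective u.
Hypothesis k_neq0 : k != 0.

(** The condition is linear in [(N, D)], unlike [N / D = d], and so allows common zeros at the
    nodes. Being sizes, [a] and [b] exceed the degree bounds by one. *)
Definition interpolates (a b : nat) (S : {set I}) (N D : {poly R}) :=
  [/\ (N != 0) || (D != 0), (size N <= a)%N, (size D <= b)%N &
      forall i, i \in S -> N.[u i] = d i * D.[u i]].

(** At a node [u i] both products equal [d i] times the product of the two denominators. *)
Lemma interpolates_cross a b a' b' (S : {set I}) n (N D N' D' : {poly R}) :
  interpolates a b S N D -> interpolates a' b' S N' D' ->
  (a + b' <= n.+1)%N -> (a' + b <= n.+1)%N ->
  (size (N * D' - N' * D)%R <= n)%N /\
  forall i, i \in S -> (N * D' - N' * D).[u i] = 0.
Proof.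
move=> [_ sN sD e] [_ sN' sD' e'] ab' a'b; split=> [|i iS]; last first.
  by rewrite hornerD hornerN !hornerM e // e' //; ring.
apply: leq_trans (size_polyD _ _) _; rewrite size_polyN geq_max.
apply/andP; split; apply: leq_trans (size_polyMleq _ _) _;
  rewrite -subn1 leq_subLR add1n.
  exact: leq_trans (leq_add sN sD') ab'.
exact: leq_trans (leq_add sN' sD) a'b.
Qed.

(** All roots of the product are real. *)
Lemma eval_i_prod_neq0 (S : {set I}) :
  eval_i (\prod_(i in S) ('X - (u i)%:P)) != 0.
Proof.
rewrite /eval_i rmorph_prod horner_prod; apply/prodf_neq0 => i _.
rewrite rmorphB /= map_polyX map_polyC hornerXsubC.
by rewrite eq_complex /= negb_and subr0 oner_eq0 orbT.
Qed.

Lemma xcircle_through (p : xplane R) : exists2 C, is_xcircle C & C p.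
Proof.
case: p => [x|].
  exists (quadric 0 1 0 (- x.1)); last by rewrite /quadric; ring.
  by apply: quadric_is_xcircle; rewrite expr1n expr0n /=; lra.
exists (quadric (0 : R) 1 0 0); last by [].
by apply: quadric_is_xcircle; rewrite expr1n expr0n /=; lra.
Qed.

(** Cross differences of solutions are all multiples of one polynomial [Pi], so they behave like
    determinants of vectors in a real plane. Two solutions with nonzero cross difference therefore
    span all others. *)
Lemma interpolates_xcircle a b (S : {set I}) : (a + b = #|S|.+2)%N ->
  exists2 C : set (xplane R), is_xcircle C &
    forall N D, interpolates a b S N D -> C (ratio_value k N D).
Proof.
move=> abS; set Pi := \prod_(i in S) ('X - (u i)%:P).
have Pi0 : Pi != 0 by apply/prodf_neq0 => i _; rewrite polyXsubC_eq0.
have cross N D N' D' : interpolates a b S N D -> interpolates a b S N' D' ->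
    exists c, N * D' - N' * D = c *: Pi.
  move=> e e'; have [||sz vn] := interpolates_cross (n := #|S|.+1) e e';
    rewrite ?abS //.
  exact: (poly_vanishing_multiple u_inj sz vn).
have [[[[N D] [N' D']] /= [e e' nz]]|deg] := pselect (exists e :
   ({poly R} * {poly R}) * ({poly R} * {poly R}),
   [/\ interpolates a b S e.1.1 e.1.2, interpolates a b S e.2.1 e.2.2 &
       e.1.1 * e.2.2 - e.2.1 * e.1.2 != 0]); last first.
  (* Here all solutions are one rational function, and any circle through its value serves. *)
  have [[[N D] /= e]|none] := pselect (exists e : {poly R} * {poly R},
      interpolates a b S e.1 e.2); last first.
    have [C Cx _] := xcircle_through None; exists C => // N D e.
    by case: none; exists (N, D).
  have [C Cx Cp] := xcircle_through (ratio_value k N D); exists C => // N' D' e'.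
  rewrite -(@ratio_value_eq _ _ k_neq0 N D) //; [by case: e | by case: e' |].
  apply/eqP; rewrite -subr_eq0 (mulrC D); apply/negPn/negP => nz.
  by apply: deg; exists ((N, D), (N', D')).
have [c ec] := cross _ _ _ _ e e'.
have c0 : c != 0 by apply: contraNneq nz => c0; rewrite ec c0 scale0r.
(* This determinant is [k * c] times the value of [Pi] at ['i]. *)
have det0 : eval_i N * (k * eval_i D') - eval_i N' * (k * eval_i D) != 0.
  rewrite mulrCA (mulrCA (eval_i N')) -mulrBr -!eval_iM -eval_iB ec eval_iZ.
  rewrite !mulf_neq0 ?eval_i_prod_neq0 //.
  by rewrite (_ : 0 = 0%:C) // (inj_eq (@complexI _)).
have [C Cx Cp] := real_pencil_xcircle det0; exists C => // N3 D3 e3.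
have [c1 ec1] := cross _ _ _ _ e3 e; have [c2 ec2] := cross _ _ _ _ e3 e'.
(* Pluecker: [v (e /\ e') = e (v /\ e') - e' (v /\ e)] for plane vectors. *)
have comb (X X' X3 : {poly R}) : (N * D' - N' * D) * X3 =
      X * (N3 * D' - N' * D3) - X' * (N3 * D - N * D3) ->
    X3 = (c2 / c) *: X + (- c1 / c) *: X'.
  rewrite ec ec1 ec2 => e3E; apply: (@mulfI _ (c *: Pi)); first by rewrite -ec.
  rewrite e3E mulNr scaleNr mulrBr -!scalerAl -!scalerAr !scalerA.
  by rewrite ![c * _]mulrC !divfK // !(mulrC _ Pi).
have eN : N3 = (c2 / c) *: N + (- c1 / c) *: N' by apply: comb; ring.
have eD : D3 = (c2 / c) *: D + (- c1 / c) *: D' by apply: comb; ring.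
move: eN eD; set al := c2 / c; set be := - c1 / c => eN eD.
have nz3 : (al != 0) || (be != 0).
  case: e3 => + _ _ _; rewrite -!negb_and; apply: contra => /andP[/eqP a0 /eqP b0].
  by rewrite eN eD a0 b0 !scale0r addr0 eqxx.
have vN : eval_i N3 = al%:C * eval_i N + be%:C * eval_i N'.
  by rewrite eN eval_iD !eval_iZ.
have vD : k * eval_i D3 = al%:C * (k * eval_i D) + be%:C * (k * eval_i D').
  by rewrite eD eval_iD !eval_iZ; ring.
rewrite (@ratio_valueE _ _ k_neq0 N3 D3 N3 D3); first by rewrite vN vD; apply: Cp.
- by case: e3.
(* Cramer's rule: if both values vanished, [al] and [be] would be zero. *)
- rewrite -negb_and; apply: contraL nz3 => /andP[/eqP N30 /eqP D30].
  rewrite N30 in vN; rewrite D30 mulr0 in vD.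
  set det := _ - _ in det0.
  have ha : al%:C * det = 0.
    transitivity ((al%:C * eval_i N + be%:C * eval_i N') * (k * eval_i D')
      - (al%:C * (k * eval_i D) + be%:C * (k * eval_i D')) * eval_i N').
      by rewrite /det; ring.
    by rewrite -vN -vD; ring.
  have hb : be%:C * det = 0.
    transitivity ((al%:C * (k * eval_i D) + be%:C * (k * eval_i D')) * eval_i N
      - (al%:C * eval_i N + be%:C * eval_i N') * (k * eval_i D)).
      by rewrite /det; ring.
    by rewrite -vN -vD; ring.
  move/eqP: ha; rewrite mulf_eq0 (negbTE det0) orbF => /eqP[->].
  by move/eqP: hb; rewrite mulf_eq0 (negbTE det0) orbF => /eqP[->]; rewrite eqxx.
- by rewrite mulrC.
Qed.

End Chain.

(** * The Clifford chain of lines in general position *)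

Section Lines.
Local Open Scope ring_scope.
Local Open Scope complex_scope.
Variables (R : realType) (I : finType).

(** The line [X + u Y = d] with [X + i Y = (1 - i s) (x + i y)]. Only the lines with [Y] constant
    are left out. *)
Definition pencil_line (s u d : R) : set (plane R) :=
  [set x : plane R | (x.1 + s * x.2) + u * (x.2 - s * x.1) = d]%classic.

Lemma pencil_chain (s : R) (u d : I -> R) : injective u ->
  (forall i j, i != j -> exists x : plane R,
     pencil_line s (u i) (d i) x /\ pencil_line s (u j) (d j) x) ->
  exists (P : {set I} -> xplane R) (C : {set I} -> set (xplane R)),
    clifford_chain (fun i => pencil_line s (u i) (d i)) P C.
Proof.
move=> u_inj meet; pose k : R[i] := 1 +i* - s.
have k0 : k != 0 by rewrite eq_complex /= oner_eq0.
(* Point and circle are chosen for every [S] by one formula; parity enters only when incidences are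
   checked. *)
pose h (S : {set I}) := #|S|./2; pose uh (S : {set I}) := uphalf #|S|.
have huh S : (h S + uh S = #|S|)%N by rewrite /h /uh uphalf_half; lia.
have /choice[e eP] (S : {set I}) : exists e : {poly R} * {poly R},
    interpolates u d (h S).+1 (uh S) S e.1 e.2.
  have [|N [D [nz sN sD eq]]] := @rational_interpolant _ _ u S d (h S).+1 (uh S).
    by rewrite addSn huh.
  by exists (N, D).
have /choice[C CP] (S : {set I}) : exists C : set (xplane R),
    is_xcircle C /\ forall N D, interpolates u d (h S).+2 (uh S) S N D ->
      C (ratio_value k N D).
  have [|C Cx Cv] := @interpolates_xcircle _ _ u d k u_inj k0 (h S).+2 (uh S) S.
    by rewrite !addSn huh.
  by exists C.
exists (fun S => ratio_value k (e S).1 (e S).2), C; split.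
- move=> i j ij; have [x [xi xj]] := meet i j ij; exists x; split=> //.
  have S2 : #|[set i; j]%SET| = 2%N by rewrite cards2 ij.
  have e1 := eP [set i; j]%SET; rewrite /h /uh S2 /= in e1.
  (* For two lines the interpolant is the linear polynomial [X + Y u] given by their intersection;
     its value at ['i] is [X + i Y], that is [k] times [x + i y]. *)
  pose E : {poly R} := (x.1 + s * x.2)%:P + (x.2 - s * x.1) *: 'X.
  have e2 : interpolates u d 2 1 [set i; j]%SET E 1.
    split; rewrite ?oner_eq0 ?orbT ?size_poly1 //.
      apply: leq_trans (size_polyD _ _) _; rewrite geq_max.
      rewrite (leq_trans (size_polyC_leq1 _)) //.
      by rewrite (leq_trans (size_scale_leq _ _)) // size_polyX.
    move=> i'; rewrite hornerD hornerZ hornerX !hornerC mulr1 !inE.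
    by rewrite (mulrC (x.2 - _)) => /orP[] /eqP ->.
  have [||sz vn] := interpolates_cross (n := 2) e1 e2 => //.
  have /eqP : (e [set i; j]%SET).1 * 1 - E * (e [set i; j]%SET).2 = 0.
    by apply: (poly_vanishing_eq0 u_inj _ vn); rewrite S2.
  rewrite subr_eq0 (mulrC E) => /eqP eqE.
  have [nz _ _ _] := e1.
  have ev1 : eval_i (1 : {poly R}) = 1 by rewrite /eval_i rmorph1 hornerC.
  rewrite (ratio_valueE k0 nz _ eqE) ev1 ?oner_eq0 ?orbT // mulr1.
  have -> : eval_i E = (x.1 +i* x.2) * k.
    rewrite eval_iD eval_iZ eval_iC eval_iX /k.
    by apply/eqP; rewrite eq_complex /=; apply/andP; split; apply/eqP; ring.
  by rewrite /xpoint (negbTE k0) mulfK //=; case: (x).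
- move=> S oS S3; have [Cx Cv] := CP S; split=> // i iS.
  have [nz sN sD eq] := eP (S :\ i)%SET.
  set N := (e _).1 in nz sN eq *; set D := (e _).2 in nz sD eq *.
  have X0 : 'X - (u i)%:P != 0 by rewrite polyXsubC_eq0.
  (* The new factor makes both sides of the condition at [i] vanish and leaves the value
     unchanged. *)
  rewrite (@ratio_value_eq _ _ k0 N D (N * ('X - (u i)%:P))
    (D * ('X - (u i)%:P))) //.
  + apply: Cv.
    have cS : #|(S :\ i)%SET| = #|S|.-1 by rewrite [#|S|](cardsD1 i) iS.
    move: sN sD; rewrite /h /uh cS => sN sD.
    split.
    * by rewrite !mulf_eq0 (negbTE X0) !orbF.
    * apply: leq_trans (size_polyMleq _ _) _; rewrite size_XsubC.
      by move: sN oS; lia.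
    * apply: leq_trans (size_polyMleq _ _) _; rewrite size_XsubC.
      by move: sD oS S3; rewrite !uphalf_half; lia.
    * move=> j jS; rewrite !hornerM hornerXsubC.
      have [->|ji] := eqVneq j i; first by rewrite subrr !mulr0.
      by rewrite eq ?mulrA // !inE ji jS.
  + by rewrite !mulf_eq0 (negbTE X0) !orbF.
  + by ring.
(* For [#|S| = 2 m] the size bounds of the point of [S] and of the circle of [S :\ i] are both
   [m + 1] and [m]; one condition is just dropped. *)
- move=> S oS S4 i iS; have [_ Cv] := CP (S :\ i)%SET; apply: Cv.
  have cS : #|(S :\ i)%SET| = #|S|.-1 by rewrite [#|S|](cardsD1 i) iS.
  have [nz sN sD eq] := eP S; split=> //.
  + by apply: leq_trans sN _; rewrite /h cS; move: oS S4; lia.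
  + by apply: leq_trans sD _; rewrite /uh cS !uphalf_half; move: oS S4; lia.
  + by move=> j; rewrite !inE => /andP[_]; apply: eq.
Qed.

(** If [s] avoids finitely many values, [X] has a nonzero coefficient in every line and can be
    normalized. Equal [u] would then mean parallel lines. *)
Lemma general_position_pencil (l : I -> set (plane R)) : general_position l ->
  exists (s : R) (u d : I -> R),
    injective u /\ l = fun i => pencil_line s (u i) (d i).
Proof.
move=> [isl npar _].
have /choice[f fP] i : exists f : R * R * R, (f.1.1 != 0 \/ f.1.2 != 0) /\
    l i = [set x : plane R | f.1.1 * x.1 + f.1.2 * x.2 = f.2]%classic.
  by have [a [b [c e]]] := isl i; exists (a, b, c).
(* This exceeds the absolute value of every quotient of coefficients, so [g i] cannot vanish; a zero
   divisor contributes [0], and then [g i] is the first coefficient. *)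
pose s := 1 + \sum_i `|(f i).1.1 / (f i).1.2|.
pose g i := (f i).1.1 + s * (f i).1.2.
have g0 i : g i != 0.
  apply/eqP => gi0; have [nz _] := fP i.
  have b0 : (f i).1.2 != 0.
    case: nz => //; apply: contraNneq => b0.
    by move: gi0; rewrite /g b0 mulr0 addr0 => ->.
  have sE : - ((f i).1.1 / (f i).1.2) = s.
    apply: (mulIf b0); rewrite mulNr divfK //; move: gi0; rewrite /g.
    by move/eqP; rewrite addr_eq0 => /eqP->; rewrite opprK.
  have : s <= `|(f i).1.1 / (f i).1.2| by rewrite -sE -normrN ler_norm.
  rewrite /s (bigD1 i) //= => le.
  have : 0 <= \sum_(j | j != i) `|(f j).1.1 / (f j).1.2| by apply: sumr_ge0.
  by lra.
pose u i := ((f i).1.2 - s * (f i).1.1) / g i.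
pose d i := (1 + s ^+ 2) * (f i).2 / g i.
have s20 : 1 + s ^+ 2 != 0 by rewrite gt_eqF // ltr_pwDl // sqr_ge0.
have lE : l = fun i => pencil_line s (u i) (d i).
  apply/funext => i; have [_ ->] := fP i; apply/seteqP.
  have E (x : plane R) : x.1 + s * x.2 + u i * (x.2 - s * x.1) - d i =
      (1 + s ^+ 2) / g i * ((f i).1.1 * x.1 + (f i).1.2 * x.2 - (f i).2).
    by rewrite /u /d; move: (g0 i); rewrite /g => gi0; field.
  split=> x /= /eqP; rewrite -subr_eq0 => /eqP e; apply/eqP; rewrite -subr_eq0.
    by rewrite E e mulr0.
  move/eqP: e; rewrite E mulf_eq0 => /orP[|//].
  by rewrite mulf_eq0 invr_eq0 (negbTE (g0 i)) (negbTE s20).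
exists s, u, d; split=> // i j uij; apply/eqP/negPn/negP => ij.
apply: (npar i j ij); rewrite lE /= uij.
have [->|dij] := eqVneq (d i) (d j); first by left.
by right=> -[x [e1 e2]]; move/eqP: dij; apply; rewrite -e1 -e2.
Qed.

Lemma clifford_chain_exists (l : I -> set (plane R)) : general_position l ->
  exists (P : {set I} -> xplane R) (C : {set I} -> set (xplane R)),
    clifford_chain l P C.
Proof.
move=> gp; have [_ npar _] := gp.
have [s [u [d [u_inj lE]]]] := general_position_pencil gp.
rewrite lE in npar *; apply: pencil_chain => // i j ij.
by apply: contrapT => nmeet; apply: (npar i j ij); right.
Qed.
End Lines.

(** * Lines and circles through given points of the plane *)

Section Plane.
Local Open Scope ring_scope.
Variable R : realType.
Implicit Types (x y z : plane R) (L M c : set (plane R)) (D : set (xplane R)).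

Lemma line_parametrization L x y z : is_line L -> x <> y -> L x -> L y ->
  L z <-> exists t, z = (x.1 + t * (y.1 - x.1), x.2 + t * (y.2 - x.2)).
Proof.
move=> [a [b [e [nz ->]]]] xy /= Lx Ly; split=> [Lz|[t ->] /=]; last first.
  transitivity ((a * x.1 + b * x.2) + t * ((a * y.1 + b * y.2) -
    (a * x.1 + b * x.2))); [ring | by rewrite Lx Ly; ring].
have det : (y.1 - x.1) * (z.2 - x.2) - (z.1 - x.1) * (y.2 - x.2) = 0.
  by apply: (@det2_eq0 _ a b); [exact/orP | lra | lra].
set q := (y.1 - x.1) ^+ 2 + (y.2 - x.2) ^+ 2.
have q0 : q != 0.
  rewrite paddr_eq0 ?sqr_ge0 // !sqrf_eq0 !subr_eq0; apply/negP.
  move=> /andP[/eqP e1 /eqP e2].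
  by apply: xy; rewrite [x]surjective_pairing -e1 -e2 -surjective_pairing.
(* The parameter of the orthogonal projection of [z] to the line through [x] and [y]. *)
exists (((y.1 - x.1) * (z.1 - x.1) + (y.2 - x.2) * (z.2 - x.2)) / q).
rewrite [LHS]surjective_pairing; congr pair; apply: (mulIf q0).
  rewrite mulrDl mulrAC divfK // /q.
  apply/eqP; rewrite -subr_eq0 -[0](mulr0 (- (y.2 - x.2))) -det; apply/eqP; ring.
rewrite mulrDl mulrAC divfK // /q.
apply/eqP; rewrite -subr_eq0 -[0](mulr0 (y.1 - x.1)) -det; apply/eqP; ring.
Qed.

Lemma line_through_unique L M x y : is_line L -> is_line M -> x <> y ->
  L x -> L y -> M x -> M y -> L = M.
Proof.
move=> lL lM xy Lx Ly Mx My; apply/funext => z; apply/propext.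
have [h1 h2] := line_parametrization z lL xy Lx Ly.
have [h3 h4] := line_parametrization z lM xy Mx My.
by split=> [/h1/h4|/h3/h2].
Qed.

(** Along the line the equation of the circle is quadratic in the parameter, with leading
    coefficient the squared distance of [x] and [y] and roots [0] and [1]. *)
Lemma line_circle_meet2 L c x y z : is_line L -> is_circle c ->
  x <> y -> x <> z -> y <> z -> L x -> L y -> L z -> c x -> c y -> c z -> False.
Proof.
move=> lL [p [q [r [_ ->]]]] xy xz yz Lx Ly.
move=> /(line_parametrization z lL xy Lx Ly)[t ez]; rewrite ez in xz yz *.
move=> /= cx cy cz.
have : t * (t - 1) * ((y.1 - x.1) ^+ 2 + (y.2 - x.2) ^+ 2) = 0.
  transitivity (((x.1 + t * (y.1 - x.1) - p) ^+ 2 +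
      (x.2 + t * (y.2 - x.2) - q) ^+ 2) - (1 - t) * ((x.1 - p) ^+ 2 +
      (x.2 - q) ^+ 2) - t * ((y.1 - p) ^+ 2 + (y.2 - q) ^+ 2)); first ring.
  by rewrite cx cy cz; ring.
move/eqP; rewrite !mulf_eq0 -orbA => /or3P[/eqP t0|t1|].
- by apply: xz; rewrite t0 !mul0r !addr0 -surjective_pairing.
- move: t1; rewrite subr_eq0 => /eqP t1; apply: yz.
  by rewrite t1 !mul1r !(addrC _ (_ - _)) !subrK -surjective_pairing.
rewrite paddr_eq0 ?sqr_ge0 // !sqrf_eq0 !subr_eq0 => /andP[/eqP e1 /eqP e2].
by apply: xy; rewrite [x]surjective_pairing -e1 -e2 -surjective_pairing.
Qed.

Lemma circle_through_unique c c' x y z : is_circle c -> is_circle c' ->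
  (forall L, is_line L -> L x -> L y -> L z -> False) ->
  c x -> c y -> c z -> c' x -> c' y -> c' z -> c = c'.
Proof.
move=> [p [q [r [_ ->]]]] [p' [q' [r' [_ ->]]]] nL /= cx cy cz cx' cy' cz'.
have [e|ne] := eqVneq (p, q) (p', q').
  by case: e cx' => <- <-; rewrite cx => ->.
(* the radical axis *)
case: (nL [set w : plane R | 2 * (p' - p) * w.1 + 2 * (q' - q) * w.2 =
   r ^+ 2 - r' ^+ 2 + p' ^+ 2 - p ^+ 2 + q' ^+ 2 - q ^+ 2]%classic).
- do 3 eexists; split; last by [].
  apply/orP; rewrite -negb_and; apply: contraNN ne.
  by rewrite !mulf_eq0 pnatr_eq0 !subr_eq0 /= => /andP[/eqP-> /eqP->].
- by rewrite /= -cx -cx'; ring.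
- by rewrite /= -cy -cy'; ring.
- by rewrite /= -cz -cz'; ring.
Qed.

Lemma xcircle_noncollinear D x y z : is_xcircle D ->
  (forall L, is_line L -> L x -> L y -> L z -> False) ->
  D (Some x) -> D (Some y) -> D (Some z) ->
  exists2 c, is_circle c & D = [set Some w | w in c]%classic.
Proof.
move=> [//|[M lM ->]] nL hx hy hz; case: (nL M) => //.
- by case: hx => [[w Mw [<-]]|].
- by case: hy => [[w Mw [<-]]|].
- by case: hz => [[w Mw [<-]]|].
Qed.

Lemma circle_eq_of_common3 c c' x y z : is_circle c -> is_circle c' ->
  x <> y -> x <> z -> y <> z ->
  c x -> c y -> c z -> c' x -> c' y -> c' z -> c = c'.
Proof.
move=> cc cc' xy xz yz cx cy cz; apply: (circle_through_unique cc cc' _ cx cy cz).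
by move=> L lL Lx Ly Lz; apply: (line_circle_meet2 lL cc xy xz yz).
Qed.

End Plane.

(** Translates between naming a vertex of three lines by its two lines and by the omitted one. *)
Lemma setD1_card3 (I : finType) (S : {set I}) (i j : I) :
  #|S| = 3%N -> i \in S -> j \in S -> i != j ->
  exists2 k, k \in S & (S :\ k = [set i; j])%SET.
Proof.
move=> S3 iS jS ij; have ijS : [set i; j]%SET \subset S.
  by rewrite finset.subUset !finset.sub1set iS.
have c1 : #|S :\: [set i; j]| = 1%N by rewrite cardsDS // cards2 ij S3.
have /cards1P[k kE] : #|S :\: [set i; j]| == 1%N by rewrite c1.
have : k \in S :\: [set i; j] by rewrite kE finset.set11.
rewrite !inE negb_or -andbA => /and3P[ki kj kS]; exists k => //.
apply/esym/eqP; rewrite eqEcard finset.subUset !finset.sub1set !inE iS jS.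
by rewrite eq_sym ki eq_sym kj /= cards2 ij; move: S3; rewrite (cardsD1 k) kS; lia.
Qed.

(** * Comparison of determined points and circles with a chain *)

Section Determined.
Variables (R : realType) (I : finType) (l : I -> set (plane R)).
Variables (P : {set I} -> xplane R) (C : {set I} -> set (xplane R)).
Hypothesis gp : general_position l.
Hypothesis chain : clifford_chain l P C.
Implicit Types (S : {set I}) (i j : I).

Lemma meet_unique i j x y : i != j -> l i x -> l j x -> l i y -> l j y -> x = y.
Proof.
move=> ij ix jx iy jy; have [isl npar _] := gp; apply: contrapT => xy.
by apply: (npar i j ij); left; apply: (line_through_unique _ _ xy).
Qed.

(** By induction the objects determined by the sets [S :\ i] belong to the chain. Hence [P S] or
    [C S] has the required incidences, and the uniqueness clause of the definition identifies it.
    Parity is carried along because the chain has incidences only in the matching parity. *)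
Lemma determined_unique S :
  (forall p, determined_point l S p -> ~~ odd #|S| /\ p = P S) /\
  (forall D, determined_circle l S D -> odd #|S| /\ D = C S).
Proof.
have [Hp Hodd Heven] := chain.
have [n] := ubnP #|S|; elim: n S => // n IHn S ltSn.
have IH i : i \in S ->
    (forall p, determined_point l (S :\ i)%SET p ->
       odd #|S| /\ p = P (S :\ i)%SET) /\
    (forall D, determined_circle l (S :\ i)%SET D ->
       ~~ odd #|S| /\ D = C (S :\ i)%SET).
  move=> iS; have cS := cardsD1 i S; rewrite iS in cS.
  have /IHn[IH1 IH2] : (#|(S :\ i)%SET| < n)%N by move: ltSn; rewrite cS.
  by rewrite cS /= negbK.
clear ltSn; split=> [p dp|D dD].
  move: IH; case: S p / dp => [i j x ij ix jx _|S c p S4 dc cp up IH].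
    rewrite cards2 ij; split=> //; have [y [iy jy ->]] := Hp i j ij.
    by rewrite (meet_unique ij ix jx iy jy).
  have {}dc i : i \in S -> ~~ odd #|S| /\ c i = C (S :\ i)%SET.
    by move=> iS; apply: (IH i iS).2; apply: dc.
  have [i0 i0S] : exists i, i \in S by apply/card_gt0P; lia.
  have [oS _] := dc i0 i0S; split=> //; apply/esym/up => i iS.
  by rewrite (dc i iS).2; apply: Heven.
move: IH; case: S D / dD => S p D S3 dp cD Dp uD IH.
have {}dp i : i \in S -> odd #|S| /\ p i = P (S :\ i)%SET.
  by move=> iS; apply: (IH i iS).1; apply: dp.
have [i0 i0S] : exists i, i \in S by apply/card_gt0P; lia.
have [oS _] := dp i0 i0S; split=> //; have [xC CP] := Hodd S oS S3.
by apply/esym/uD => // i iS; rewrite (dp i iS).2; apply: CP.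
Qed.

Lemma vertex_on_circle S i j : #|S| = 3%N -> i \in S -> j \in S -> i != j ->
  C S (P [set i; j]%SET).
Proof.
move=> S3 iS jS ij; have [k kS <-] := setD1_card3 S3 iS jS ij.
by have [_ Hodd _] := chain; apply: (Hodd S _ _).2; rewrite ?S3.
Qed.

Lemma vertices_neq i j k x y : i != j -> i != k -> j != k ->
  l i x -> l j x -> l i y -> l k y -> x <> y.
Proof.
move=> ij ik jk ix jx iy ky xy; have [_ _ nc] := gp.
by apply: (nc i j k ij ik jk); exists x; split=> //; rewrite xy.
Qed.

(** A line through all three would share two distinct points with [l i] and with [l j], hence equal
    both. *)
Lemma vertices_noncollinear i j k x y z : i != j -> i != k -> j != k ->
  l i x -> l j x -> l i y -> l k y -> l j z -> l k z ->
  forall L, is_line L -> L x -> L y -> L z -> False.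
Proof.
move=> ij ik jk ix jx iy ky jz kz L lL Lx Ly Lz; have [isl npar _] := gp.
have xy : x <> y by apply: (vertices_neq ij ik jk).
have ji : j != i by rewrite eq_sym.
have xz : x <> z by apply: (vertices_neq ji jk ik).
have e1 : l i = L by apply: (line_through_unique _ _ xy).
have e2 : l j = L by apply: (line_through_unique _ _ xz).
by apply: (npar i j ij); left; rewrite e1 e2.
Qed.

Lemma determined_point2 S : #|S| = 2%N -> determined_point l S (P S).
Proof.
move=> /eqP/cards2P[i [j [ij ->]]]; have [Hp _ _] := chain.
by have [x [ix jx ->]] := Hp i j ij; apply: Determined_intersection.
Qed.

(** Noncollinearity of the vertices rules out a straight line through [None] and makes the circle
    unique. *)
Lemma determined_circle3 S : #|S| = 3%N -> exists c,
  [/\ is_circle c, C S = [set Some x | x in c]%classic &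
      determined_circle l S (C S)].
Proof.
move=> S3; have [Hp Hodd _] := chain.
have [||xC CP] := Hodd S; rewrite ?S3 //.
have /card_gt2P[i [j [k [[iS jS kS] [ij jk ki]]]]] : (2 < #|S|)%N by rewrite S3.
have ik : i != k by rewrite eq_sym.
have [x [ix jx eij]] := Hp i j ij.
have [y [iy ky eik]] := Hp i k ik.
have [z [jz kz ejk]] := Hp j k jk.
have ncol := vertices_noncollinear ij ik jk ix jx iy ky jz kz.
have vC a b w : a \in S -> b \in S -> a != b -> P [set a; b]%SET = Some w ->
  C S (Some w) by move=> aS bS ab <-; apply: vertex_on_circle.
have [c cc cE] := xcircle_noncollinear xC ncol (vC _ _ _ iS jS ij eij)
  (vC _ _ _ iS kS ik eik) (vC _ _ _ jS kS jk ejk).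
exists c; split=> //; apply: (Determined_circle (p := fun a => P (S :\ a)%SET)).
- by rewrite S3.
- move=> a aS; apply: determined_point2.
  by move: S3; rewrite (cardsD1 a) aS => -[].
- by [].
- by [].
move=> D xD DP.
have vD a b w : a \in S -> b \in S -> a != b -> P [set a; b]%SET = Some w ->
    D (Some w).
  move=> aS bS ab <-; have [t tS <-] := setD1_card3 S3 aS bS ab; exact: DP.
have [c' cc' cE'] := xcircle_noncollinear xD ncol (vD _ _ _ iS jS ij eij)
  (vD _ _ _ iS kS ik eik) (vD _ _ _ jS kS jk ejk).
have somec (E : set (xplane R)) c0 w :
    E = [set Some x | x in c0]%classic -> E (Some w) -> c0 w.
  by move=> -> [v cv [<-]].
rewrite cE cE'; congr ([set Some w | w in _]%classic).
apply: (circle_through_unique cc' cc ncol).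
- exact/(somec _ _ _ cE')/(vD i j).
- exact/(somec _ _ _ cE')/(vD i k).
- exact/(somec _ _ _ cE')/(vD j k).
- exact/(somec _ _ _ cE)/(vC i j).
- exact/(somec _ _ _ cE)/(vC i k).
- exact/(somec _ _ _ cE)/(vC j k).
Qed.

(** These are three distinct points of [l i]. *)
Lemma vertices_of_line_not_concyclic i j k t c :
  i != j -> i != k -> i != t -> j != k -> j != t -> k != t -> is_circle c ->
  ([set Some x | x in c] (P [set i; j]%SET))%classic ->
  ([set Some x | x in c] (P [set i; k]%SET))%classic ->
  ([set Some x | x in c] (P [set i; t]%SET))%classic -> False.
Proof.
move=> ij ik it jk jt kt cc; have [Hp _ _] := chain; have [isl _ _] := gp.
have [x [ix jx ->]] := Hp i j ij.
have [y [iy ky ->]] := Hp i k ik.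
have [z [iz tz ->]] := Hp i t it.
move=> [x' cx [ex]] [y' cy [ey]] [z' cz [ez]]; move: cx cy cz; rewrite ex ey ez.
apply: (line_circle_meet2 (isl i) cc) => //.
- exact: (vertices_neq ij ik jk).
- exact: (vertices_neq ij it jt).
- exact: (vertices_neq ik it kt).
Qed.

(** The circles of triples avoid [None], so common points are finite. A second common point would
    put three vertices of one line on one circle. *)
Lemma determined_point4 S : #|S| = 4%N -> exists2 x,
  P S = Some x & determined_point l S (P S).
Proof.
move=> S4; have [Hp _ Heven] := chain.
have card3 i : i \in S -> #|(S :\ i)%SET| = 3%N.
  by move=> iS; move: S4; rewrite (cardsD1 i) iS => -[].
have CP i : i \in S -> C (S :\ i)%SET (P S).
  by move=> iS; apply: Heven; rewrite ?S4.
have circ i : i \in S -> exists2 c, is_circle c &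
    C (S :\ i)%SET = [set Some x | x in c]%classic.
  by move=> iS; have [c [cc cE _]] := determined_circle3 (card3 i iS); exists c.
have vC a i j : a \in S -> i \in S -> j \in S -> i != j -> i != a -> j != a ->
    C (S :\ a)%SET (P [set i; j]%SET).
  move=> aS iS jS ij ia ja; apply: vertex_on_circle; rewrite ?card3 //.
    by rewrite !inE ia.
  by rewrite !inE ja.
have somec a x c : C (S :\ a)%SET = [set Some w | w in c]%classic ->
    C (S :\ a)%SET (Some x) -> c x by move=> -> [v cv [<-]].
have [i0 i0S] : exists i, i \in S by apply/card_gt0P; rewrite S4.
have [p pE] : exists p, P S = Some p.
  by have [c _ cE] := circ i0 i0S; have := CP i0 i0S;
    rewrite cE => -[p _ <-]; exists p.
exists p => //; apply: (Determined_point (c := fun i => C (S :\ i)%SET)).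
- by rewrite S4.
- by move=> i iS; have [c []] := determined_circle3 (card3 i iS).
- exact: CP.
move=> q qC.
have [q' qE] : exists q', q = Some q'.
  by have [c _ cE] := circ i0 i0S; have := qC i0 i0S;
    rewrite cE => -[q' _ <-]; exists q'.
rewrite qE pE in qC CP *; apply: contrapT => qp.
have {}qp : p <> q' by move=> e; apply: qp; rewrite e.
have [a [b [e [f [[aS bS eS fS] [ab ae af] [be bf ef]]]]]] : exists a b e f,
    [/\ [/\ a \in S, b \in S, e \in S & f \in S],
        [/\ a != b, a != e & a != f] & [/\ b != e, b != f & e != f]].
  have := enum_uniq S; have := mem_enum S; have := S4; rewrite cardE.
  case: (enum S) => [|a [|b [|e [|f []]]]] //= _ mem.
  rewrite !inE !negb_or => /and4P[/and3P[? ? ?] /andP[? ?] ? _].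
  exists a, b, e, f; split; split=> //; rewrite -mem !inE eqxx ?orbT //.
have [ca cca caE] := circ a aS.
have [ce cce ceE] := circ e eS; have [cf ccf cfE] := circ f fS.
have [x [ax bx xE]] := Hp a b ab.
(* If the vertex of [a] and [b] is a common point, the circle omitting [a] contains all three
   vertices on [l b]. *)
have [xpq|xpq] := pselect (x = p \/ x = q').
  have ba : b != a by rewrite eq_sym.
  apply: (vertices_of_line_not_concyclic ba be bf ae af ef cca); rewrite -caE.
  - by rewrite finset.setUC xE; case: xpq => ->; [exact: CP|exact: qC].
  - by apply: vC => //; rewrite eq_sym.
  - by apply: vC => //; rewrite eq_sym.
have xp : x <> p by move=> h; apply: xpq; left.
have xq : x <> q' by move=> h; apply: xpq; right.
(* Otherwise the circles omitting [e] and [f] share three points. As one circle they contain all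
   three vertices on [l a]. *)
have cef : ce = cf.
  apply: (circle_eq_of_common3 cce ccf xp xq qp).
  - by apply: (somec _ _ _ ceE); rewrite -xE; apply: vC.
  - exact/(somec _ _ _ ceE)/CP.
  - exact/(somec _ _ _ ceE)/qC.
  - by apply: (somec _ _ _ cfE); rewrite -xE; apply: vC.
  - exact/(somec _ _ _ cfE)/CP.
  - exact/(somec _ _ _ cfE)/qC.
apply: (vertices_of_line_not_concyclic ab ae af be bf ef cce); rewrite -ceE.
- exact: vC.
- by rewrite ceE cef -cfE; apply: vC.
- by apply: vC => //; rewrite eq_sym.
Qed.

End Determined.

Theorem theorem1p1 (R : realType) :
  (* (i) *)
  (forall l : 'I_3 -> set (plane R), general_position l ->
     exists c : set (plane R),
       [/\ is_circle c,
           forall i j x, i != j -> l i x -> l j x -> c x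
         & determined_circle l [set: 'I_3]%SET [set Some x | x in c]%classic]) /\
  (* (ii) *)
  (forall l : 'I_4 -> set (plane R), general_position l ->
     exists (c : 'I_4 -> set (plane R)) (x : plane R),
       [/\ forall i, is_circle (c i),
           forall i, determined_circle l [set~ i]%SET
                       [set Some y | y in c i]%classic,
           forall i, c i x
         & determined_point l [set: 'I_4]%SET (Some x)]) /\
  (* (iii) *)
  (forall l : 'I_5 -> set (plane R), general_position l ->
     exists p : 'I_5 -> plane R,
       (forall i, determined_point l [set~ i]%SET (Some (p i))) /\
       (exists C, is_xcircle C /\ forall i, C (Some (p i)))) /\
  (* (iv) *)
  (forall l : 'I_6 -> set (plane R), general_position l ->
     forall C : 'I_6 -> set (xplane R),
       (forall i, determined_circle l [set~ i]%SET (C i)) ->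
       exists p, forall i, C i p) /\
  (* every n >= 2 *)
  (forall n : nat, (2 <= n)%N ->
     (forall l : 'I_(2 * n) -> set (plane R), general_position l ->
        forall C : 'I_(2 * n) -> set (xplane R),
          (forall i, determined_circle l [set~ i]%SET (C i)) ->
          exists p, forall i, C i p) /\
     (forall l : 'I_(2 * n).+1 -> set (plane R), general_position l ->
        forall p : 'I_(2 * n).+1 -> xplane R,
          (forall i, determined_point l [set~ i]%SET (p i)) ->
          exists C, is_xcircle C /\ forall i, C (p i))) /\
  (* the chain exists also when some circle or point is not unique *)
  (forall (N : nat) (l : 'I_N -> set (plane R)), general_position l ->
     exists (P : {set 'I_N} -> xplane R) (C : {set 'I_N} -> set (xplane R)),
       clifford_chain l P C).
Proof.
have set1CE N (i : 'I_N) : ([set~ i] = [set: 'I_N] :\ i)%SET.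
  by apply/setP => j; rewrite !inE andbT.
have cardC N (i : 'I_N.+1) : #|[set~ i]%SET| = N.
  by rewrite cardsC1 card_ord.
(* The given circles are those of the chain, so its point for the full set lies on all of them. *)
have even_case n : (2 <= n)%N -> forall l : 'I_(2 * n) -> set (plane R),
    general_position l -> forall C : 'I_(2 * n) -> set (xplane R),
      (forall i, determined_circle l [set~ i]%SET (C i)) ->
      exists p, forall i, C i p.
  move=> n2 l gp C dC; have [P [C' chain]] := clifford_chain_exists gp.
  exists (P [set: 'I_(2 * n)]%SET) => i.
  have [_ /(_ _ (dC i))[_ ->]] := determined_unique gp chain [set~ i]%SET.
  have [_ _ Heven] := chain.
  by rewrite set1CE; apply: Heven; rewrite ?cardsT ?card_ord ?inE //; lia.
split.
  move=> l gp; have [P [C chain]] := clifford_chain_exists gp.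
  have T3 : #|[set: 'I_3]%SET| = 3 by rewrite cardsT card_ord.
  have [c [cc cE dc]] := determined_circle3 gp chain T3.
  exists c; split; rewrite -?cE // => i j x ij ix jx.
  have : C [set: 'I_3]%SET (P [set i; j]%SET).
    by apply: (vertex_on_circle chain T3); rewrite ?inE.
  have [Hp _ _] := chain; have [y [iy jy ->]] := Hp i j ij.
  by rewrite (meet_unique gp ij ix jx iy jy) cE => -[z cz [<-]].
split.
  move=> l gp; have [P [C chain]] := clifford_chain_exists gp.
  have T4 : #|[set: 'I_4]%SET| = 4 by rewrite cardsT card_ord.
  have [x xE dx] := determined_point4 gp chain T4.
  have /choice[c cP] (i : 'I_4) : exists c, [/\ is_circle c,
      C [set~ i]%SET = [set Some y | y in c]%classic &
      determined_circle l [set~ i]%SET (C [set~ i]%SET)].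
    exact: (determined_circle3 gp chain (cardC 3 i)).
  have [_ _ Heven] := chain.
  exists c, x; split=> [i|i|i|].
  - by have [] := cP i.
  - by have [_ <-] := cP i.
  - have [_ cE _] := cP i.
    have : C [set~ i]%SET (P [set: 'I_4]%SET).
      by rewrite set1CE; apply: Heven; rewrite ?T4 ?inE.
    by rewrite cE xE => -[y cy [<-]].
  - by rewrite -xE.
split.
  (* The four-line case makes the five points determined and finite; their circle comes from the
     chain and may be a straight line. *)
  move=> l gp; have [P [C chain]] := clifford_chain_exists gp.
  have /choice[p pP] (i : 'I_5) : exists p, P [set~ i]%SET = Some p /\
      determined_point l [set~ i]%SET (P [set~ i]%SET).
    by have [p] := determined_point4 gp chain (cardC 4 i); exists p.
  exists p; split=> [i|]; first by have [<-] := pP i.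
  have [_ Hodd _] := chain; have [||xC CP] := Hodd [set: 'I_5]%SET.
  - by rewrite cardsT card_ord.
  - by rewrite cardsT card_ord.
  by exists (C [set: 'I_5]%SET); split=> // i; have [<- _] := pP i;
    rewrite set1CE; apply: CP; rewrite inE.
split; first exact: (even_case 3 isT).
split; last by move=> N l; apply: clifford_chain_exists.
move=> n n2; split=> [|l gp p dp]; first exact: even_case.
have [P [C chain]] := clifford_chain_exists gp.
have [_ Hodd _] := chain; have [||xC CP] := Hodd [set: 'I_(2 * n).+1]%SET.
- by rewrite cardsT card_ord; lia.
- by rewrite cardsT card_ord; lia.
exists (C [set: 'I_(2 * n).+1]%SET); split=> // i.
have [/(_ _ (dp i))[_ ->] _] := determined_unique gp chain [set~ i]%SET.
by rewrite set1CE; apply: CP; rewrite inE.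
Qed.
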